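(* Let $p$ be a prime, let $m>0$ and $n\geq 2$ be integers, let $q=p^m$, let $\mathcal{F}$ be a field with $q$ elements, and let $\mathcal{S}=\mathrm{SL}(n,q)$ be the group of $n\times n$ matrices with determinant $1$ over $\mathcal{F}$. Let $A$ and $B$ be matrices in $\mathcal{S}$. Then one of the following holds: (i) $A^{\mathcal{S}}B^{\mathcal{S}}=(AB)^{\mathcal{S}}$ and at least one of $A$, $B$ is a scalar matrix. (ii) $A^{\mathcal{S}}B^{\mathcal{S}}$ is the union of at least $\left\lceil\frac{q}{2}\right\rceil$ distinct conjugacy classes of $\mathcal{S}$, i.e. $\eta(A^{\mathcal{S}}B^{\mathcal{S}})\geq\left\lceil\frac{q}{2}\right\rceil$.
   Context: For a finite group $\mathcal{S}$ and $A\in\mathcal{S}$, $A^{\mathcal{S}}=\{A^B\mid B\in\mathcal{S}\}$ denotes the conjugacy class of $A$ in $\mathcal{S}$, where $A^B=B^{-1}AB$. For $A,B\in\mathcal{S}$, $A^{\mathcal{S}}B^{\mathcal{S}}=\{XY\mid X\in A^{\mathcal{S}},\,Y\in B^{\mathcal{S}}\}$; this set is invariant under conjugation by $\mathcal{S}$, hence is a union of conjugacy classes of $\mathcal{S}$. For a nonempty conjugation-invariant subset $\mathcal{X}\subseteq\mathcal{S}$, $\eta(\mathcal{X})$ denotes the number of distinct conjugacy classes of $\mathcal{S}$ whose union is $\mathcal{X}$. *)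

(* Defs.v *)
From HB Require Import structures.
From mathcomp Require Import all_boot all_algebra all_fingroup.

Set Implicit Arguments.
Unset Strict Implicit.
Unset Printing Implicit Defensive.

Import GroupScope GRing.Theory.

(* {'GL_n[F]} consists of the units of 'M[F]_n.-1.+1, so SLgroup n F is SL(n, F)
   for n > 0. *)
Definition SLgroup (n : nat) (F : finFieldType) : {set {'GL_n[F]}} :=
  [set u | (\det (GLval u) == 1)%R].

Lemma SLgroup_group_set (n : nat) (F : finFieldType) : group_set (SLgroup n F).
Proof.
apply/group_setP; split=> [|u v]; first by rewrite inE GL_1E det1.
by rewrite !inE GL_ME det_mulmx => /eqP-> /eqP->; rewrite mulr1.
Qed.

Canonical SLgroup_group (n : nat) (F : finFieldType) : {group {'GL_n[F]}} :=
  group (SLgroup_group_set n F).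

(* Meaningful when X is a G-invariant subset of G, so that X is the disjoint
   union of the classes counted here (see cover_class_count). *)
Definition class_count (gT : finGroupType) (G X : {set gT}) : nat :=
  #|[set C in classes G | C \subset X]|.

Lemma cover_class_count (gT : finGroupType) (G : {group gT}) (X : {set gT}) :
  X \subset G -> G \subset 'N(X) ->
  cover [set C in classes G | C \subset X] = X.
Proof.
move=> sXG nXG; apply/setP=> x; apply/bigcupP/idP=> [[C]|Xx].
  by rewrite inE => /andP[_ /subsetP sCX] /sCX.
exists (x ^: G); last exact: class_refl.
by rewrite inE mem_classes ?(subsetP sXG) //= class_sub_norm.
Qed.

Lemma class_mul_norm (gT : finGroupType) (G : {group gT}) (x y : gT) :
  G \subset 'N(x ^: G * y ^: G).
Proof. by rewrite normsM ?class_norm. Qed.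

(* Main.v *)
Require Import Defs.
From HB Require Import structures.
From mathcomp Require Import all_boot all_algebra all_fingroup.
From mathcomp Require Import ring.

(** If [A] or [B] is scalar, it is central and [A^S B^S = (AB)^S].  Otherwise both
    have [S]-conjugates [a] and [b] whose entries at one fixed off-diagonal
    position [(j, i)] are nonzero.  Conjugating [a] by the transvections
    [1 + t E_ij] gives
      [tr (a^(1 + t E_ij) b) = tr (a b) + c t - a_ji b_ji t^2],
    a quadratic polynomial in [t], which takes each value at most twice.  Hence
    the trace takes at least [q / 2] values on [A^S B^S]. *)

Set Implicit Arguments.
Unset Strict Implicit.
Unset Printing Implicit Defensive.

Import GroupScope.

(** * Polynomial values, transvections and traces over a field *)

Section Matrices.

Import GRing.Theory.
Local Open Scope ring_scope.

(** The fibre over [y] consists of roots of [p - y%:P]. As [p] is not constant, this polynomial has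
    the size of [p], so each fibre has at most [(size p).-1] points. *)
Lemma card_poly_image (F : finFieldType) (p : {poly F}) :
  (1 < size p)%N -> (#|F| <= (size p).-1 * #|[set p.[x] | x : F]|)%N.
Proof.
move=> p_gt1; rewrite mulnC -sum_nat_const -[leqLHS]sum1_card.
rewrite (partition_big_imset (fun x => p.[x])) leq_sum //= => y _.
rewrite sum1dep_card.
have szpy : size (p - y%:P) = size p.
  by rewrite size_polyDl // size_polyN (leq_ltn_trans (size_polyC_leq1 y)).
rewrite -ltnS (ltn_predK p_gt1) cardE -szpy max_poly_roots ?enum_uniq //.
  by rewrite -size_poly_gt0 szpy ltnW.
by apply/allP=> x; rewrite mem_enum inE rootE !hornerE subr_eq0.
Qed.

Definition transvection (F : fieldType) n (i j : 'I_n) (t : F) : 'M[F]_n :=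
  1%:M + t *: delta_mx i j.

Lemma transvection_mul_opp (F : fieldType) n (i j : 'I_n) (t : F) :
  i != j -> transvection i j t *m transvection i j (- t) = 1%:M.
Proof.
move=> neq_ij; rewrite /transvection mulmxDl mul1mx mulmxDr mulmx1.
rewrite -scalemxAl -scalemxAr mul_delta_mx_cond eq_sym (negPf neq_ij).
by rewrite mulr0n !scaler0 addr0 scaleNr -addrA addNr addr0.
Qed.

(** For [j < i] the matrix is lower triangular with ones on the diagonal. *)
Lemma det_transvection (F : fieldType) n (i j : 'I_n) (t : F) :
  (j < i)%N -> \det (transvection i j t) = 1.
Proof.
move=> lt_ji; rewrite det_trig.
  rewrite big1 // => k _; rewrite !mxE eqxx.
  by case: eqP => [->|_]; rewrite ?mulr0 ?addr0 // -val_eqE gtn_eqF // mulr0 addr0.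
apply/is_trig_mxP => k l lt_kl; rewrite !mxE -val_eqE ltn_eqF //.
case: eqP => [ki|_]; case: eqP => [lj|_] /=; rewrite ?mulr0 ?addr0 //.
by move: lt_kl; rewrite ki lj ltnNge ltnW.
Qed.

Lemma delta_mulmx_delta (F : fieldType) n (i j : 'I_n) (A : 'M[F]_n) :
  delta_mx i j *m A *m delta_mx i j = A j i *: delta_mx i j.
Proof.
apply/matrixP=> k l; rewrite !mxE (bigD1 i) //= big1 => [|k' ne_k'i].
  rewrite !mxE (bigD1 j) //= big1 => [|l' ne_l'j]; rewrite !mxE ?eqxx /=.
    by case: (k == i); case: (l == j); rewrite /= ?mul1r ?mul0r ?mulr1 ?mulr0 ?addr0.
  by rewrite (negPf ne_l'j) andbF mul0r.
by rewrite !mxE (negPf ne_k'i) mulr0.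
Qed.

Lemma trace_delta_mul (F : fieldType) n (i j : 'I_n) (A : 'M[F]_n) :
  \tr (delta_mx i j *m A) = A j i.
Proof.
rewrite /mxtrace (bigD1 i) //= big1 => [|k ne_ki]; rewrite mxE.
  rewrite (bigD1 j) //= big1 => [|l ne_lj]; rewrite !mxE ?eqxx ?mul1r ?addr0 //.
  by rewrite (negPf ne_lj) andbF mul0r.
by rewrite big1 // => l _; rewrite mxE (negPf ne_ki) mul0r.
Qed.

(** With [E = delta_mx i j], the quadratic term is governed by [E A E = A j i *: E] and
    [\tr (E B) = B j i]. Of [c] only its independence of [t] matters. *)
Lemma trace_transvection_conj (F : fieldType) n (i j : 'I_n) (A B : 'M[F]_n) :
  exists c, forall t,
    \tr (transvection i j (- t) *m A *m transvection i j t *m B) =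
    \tr (A *m B) + c * t - A j i * B j i * t ^+ 2.
Proof.
pose E : 'M[F]_n := delta_mx i j.
exists (\tr (A *m E *m B) - \tr (E *m A *m B)) => t.
rewrite /transvection -/E !(mulmxDl, mulmxDr) !mul1mx !mulmx1.
rewrite -!scalemxAl -!scalemxAr -!scalemxAl delta_mulmx_delta -!scalemxAl.
rewrite !mxtraceD !mxtraceZ trace_delta_mul; ring.
Qed.

(** This turns two distinct diagonal entries of a diagonal matrix into a nonzero off-diagonal
    entry. *)
Lemma diag_conj_entry (F : fieldType) n (A : 'M[F]_n) (i j : 'I_n) :
  is_diag_mx A -> i != j ->
  (transvection i j (-1) *m A *m transvection i j 1) i j = A i i - A j j.
Proof.
move=> /is_diag_mxP dA neq_ij.
rewrite /transvection mulmxDl mul1mx mulmxDr mulmx1 scale1r scaleN1r mulmxDl.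
rewrite !mulNmx delta_mulmx_delta !mxE.
rewrite (bigD1 j) //= big1 => [|k ne_kj]; last first.
  by rewrite mxE (negPf ne_kj) andbF mul0r.
rewrite (bigD1 i) //= big1 => [|k ne_ki]; last first.
  by rewrite mxE (negPf ne_ki) mulr0.
rewrite !mxE !eqxx (dA i j) ?(dA j i) //; last by rewrite eq_sym.
by rewrite /=; ring.
Qed.

(** * Moving a nonzero entry to a prescribed off-diagonal position *)

Lemma perm_pair (T : finType) (x y x' y' : T) :
  x != y -> x' != y' -> exists s : {perm T}, s x = x' /\ s y = y'.
Proof.
move=> neq_xy neq_xy'; pose r := tperm x x'.
(* The first transposition sends [x] to [x']; the second corrects the image of [y] and fixes
   [x']. *)
exists (r * tperm (r y) y')%g; rewrite !permM; split; last exact: tpermL.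
rewrite /r tpermL -/r tpermD //; last by rewrite eq_sym.
by rewrite -[x'](tpermL x x') (inj_eq perm_inj) eq_sym.
Qed.

(** First some off-diagonal entry is made nonzero: a non-diagonal matrix has one already, and a
    diagonal nonscalar one is conjugated by a transvection. A permutation matrix then moves that
    entry to [(i, j)]. *)
Lemma nonscalar_conj_entry (F : fieldType) n (A : 'M[F]_n) (i j : 'I_n) :
  i != j -> ~~ is_scalar_mx A ->
  exists2 P : 'M[F]_n, P \in unitmx & (invmx P *m A *m P) i j != 0.
Proof.
move=> neq_ij nsA.
have [P [uP [k [l [neq_kl PAkl]]]]] : exists P : 'M[F]_n, P \in unitmx /\
    exists k l, k != l /\ (invmx P *m A *m P) k l != 0.
  have [dA|] := boolP (is_diag_mx A).
    have [/existsP[k /existsP[l neq_A]]|/existsPn eqA] :=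
      boolP [exists k, exists l, A k k != A l l].
      have neq_kl : k != l by apply: contraNneq neq_A => ->.
      have inv1 := transvection_mul_opp (1 : F) neq_kl.
      have [uP _] := mulmx1_unit inv1.
      exists (transvection k l 1); split=> //; exists k, l; split=> //.
      have -> : invmx (transvection k l (1 : F)) = transvection k l (-1 : F).
        by rewrite -[invmx _]mulmx1 -inv1 mulKmx.
      by rewrite diag_conj_entry // subr_eq0.
    case/negP: nsA; apply/is_scalar_mxP; exists (A i i).
    apply/matrixP=> k l; rewrite mxE; have [<-|neq_kl] := eqVneq k l.
      by apply/eqP; move/existsPn/(_ i): (eqA k); rewrite negbK.
    by rewrite (is_diag_mxP dA).
  rewrite /is_diag_mx negb_forall => /existsP[k]; rewrite negb_forall.
  case/existsP=> l; rewrite negb_imply => /andP[neq_kl Akl].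
  exists 1%:M; rewrite unitmx1; split=> //; exists k, l; split=> //.
  by rewrite invmx1 mul1mx mulmx1.
have [s [si sj]] := perm_pair neq_ij neq_kl.
(* The [(i, j)] entry of [perm_mx s *m M *m perm_mx s^-1] is [M (s i) (s j)], that is, [M k l]. *)
exists (P *m perm_mx s^-1); first by rewrite unitmx_mul uP unitmx_perm.
suff -> : invmx (P *m perm_mx s^-1) = perm_mx s *m invmx P.
  by rewrite !mulmxA -col_permE mxE -!mulmxA -row_permE mxE si sj mulmxA.
rewrite -[LHS]mulmx1; apply: (canLR (mulKmx _)).
  by rewrite unitmx_mul uP unitmx_perm.
by rewrite mulmxA -(mulmxA P) -perm_mxM mulVg perm_mx1 mulmx1 mulmxV.
Qed.

(* An off-diagonal entry is only rescaled by a nonzero factor when one conjugates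
   by a diagonal matrix, which is used to normalise the determinant. *)
Lemma nonscalar_SL_conj_entry (F : fieldType) n (A : 'M[F]_n) (i j : 'I_n) :
  i != j -> ~~ is_scalar_mx A ->
  exists2 P : 'M[F]_n, \det P = 1 & (invmx P *m A *m P) i j != 0.
Proof.
move=> neq_ij /(nonscalar_conj_entry neq_ij)[P uP PAij].
have detP : \det P != 0 by rewrite -unitfE -unitmxE.
(* One diagonal entry [(\det P)^-1] suffices to bring the determinant of the product to 1. *)
pose r : 'rV[F]_n := \row_k (if k == j then (\det P)^-1 else 1).
have detD : \det (diag_mx r) = (\det P)^-1.
  rewrite det_diag (bigD1 j) //= big1 => [|k /negPf nkj]; rewrite mxE ?nkj //.
  by rewrite eqxx mulr1.
have uD : diag_mx r \in unitmx by rewrite unitmxE detD unitfE invr_eq0.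
exists (P *m diag_mx r); first by rewrite det_mulmx detD divff.
set Q := P *m diag_mx r.
have uQ : Q \in unitmx by rewrite unitmx_mul uP.
apply: contraNneq PAij => QAij.
have: (diag_mx r *m (invmx Q *m A *m Q)) i j = 0.
  by rewrite mul_diag_mx mxE QAij mulr0.
(* Since [Q = P D] with [D = diag_mx r], the factor [D] moves across the conjugate; the [(i, j)]
   entries are then compared. *)
have -> : diag_mx r *m (invmx Q *m A *m Q) = invmx P *m A *m P *m diag_mx r.
  have {1}-> : diag_mx r = invmx P *m Q by rewrite mulKmx.
  by rewrite -!mulmxA -/Q (mulmxA P (diag_mx r)) -/Q mulKVmx.
rewrite mul_mx_diag mxE [r _ _]mxE eqxx => /eqP.
by rewrite mulf_eq0 invr_eq0 (negPf detP) orbF => /eqP ->.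
Qed.

End Matrices.

(** * Passage to the groups, and counting of classes *)

Lemma SL_val (n : nat) (F : finFieldType) (P : 'M[F]_n.-1.+1) :
  (\det P = 1)%R -> exists2 g, g \in SLgroup n F & GLval g = P.
Proof.
move=> detP; have uP : P \in unitmx by rewrite unitmxE detP GRing.unitr1.
by exists (FinRing.unit 'M[F]_n.-1.+1 uP); rewrite // inE /= detP.
Qed.

Lemma GL_conj_val (n : nat) (F : finFieldType) (A g : {'GL_n[F]}) :
  GLval (A ^ g) = (invmx (GLval g) *m GLval A *m GLval g)%R.
Proof. by rewrite conjgE mulgA !GL_MxE GL_VxE. Qed.

Lemma mxtrace_conj (n : nat) (F : finFieldType) (A g : {'GL_n[F]}) :
  (\tr (GLval (A ^ g)) = \tr (GLval A))%R.
Proof.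
rewrite GL_conj_val mxtrace_mulC mulmxA mulmxV ?mul1mx //.
exact: (GL_unitmx g).
Qed.

Lemma scalar_GL_central (n : nat) (F : finFieldType) (A B : {'GL_n[F]}) :
  is_scalar_mx (GLval A) -> commute A B.
Proof.
move=> /is_scalar_mxP[a Aa]; apply: val_inj.
by rewrite [LHS]GL_MxE [RHS]GL_MxE Aa scalar_mxC.
Qed.

Lemma class_mul_cent (gT : finGroupType) (G : {group gT}) (x y : gT) :
  x \in 'C(G) -> x ^: G * y ^: G = (x * y) ^: G.
Proof.
move=> cGx; have xg g : g \in G -> x ^ g = x.
  by move=> Gg; apply/conjg_fixP/commgP/(centP cGx).
have -> : x ^: G = [set x].
  apply/setP=> z; rewrite inE; apply/imsetP/eqP=> [[g Gg ->]|->]; first exact: xg.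
  by exists 1; rewrite ?conjg1.
apply/setP=> z; apply/mulsgP/imsetP=> [[_ _ /set1P-> /imsetP[g Gg ->] ->]|[g Gg ->]].
  by exists g; rewrite // conjMg xg.
exists x (y ^ g); rewrite ?set11 ?memJ_class //.
by rewrite conjMg xg.
Qed.

(** Each value [f (h i)] is recovered from the representative of the class of [h i], a class
    contained in [X]; so distinct values come from distinct classes. *)
Lemma card_class_count (gT : finGroupType) (G : {group gT}) (T I : finType)
    (f : gT -> T) (h : I -> gT) (X : {set gT}) :
    {in X & G, forall x g, f (x ^ g) = f x} ->
    X \subset G -> G \subset 'N(X) -> (forall i, h i \in X) ->
  #|[set f (h i) | i : I]| <= class_count G X.
Proof.
move=> fJ sXG nXG Xh; pose C := [set C in classes G | C \subset X].
rewrite /class_count -/C; apply: leq_trans (leq_imset_card (fun D => f (repr D)) _).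
apply/subset_leq_card/subsetP=> _ /imsetP[i _ ->]; apply/imsetP.
exists (h i ^: G).
  by rewrite inE mem_classes ?(subsetP sXG) //= class_sub_norm.
by have /imsetP[g Gg ->] := mem_repr _ (class_refl G (h i)); rewrite fJ.
Qed.

Lemma class_count_nonscalar (n : nat) (F : finFieldType) (A B : {'GL_n.+2[F]}) :
    A \in SLgroup n.+2 F -> B \in SLgroup n.+2 F ->
    ~~ is_scalar_mx (GLval A) -> ~~ is_scalar_mx (GLval B) ->
  uphalf #|F| <= class_count (SLgroup n.+2 F) (A ^: SLgroup n.+2 F * B ^: SLgroup n.+2 F).
Proof.
set S := SLgroup _ _ => SA SB nsA nsB.
(* The extreme indices give [j < i] by computation, as [det_transvection] requires. *)
pose i : 'I_n.+2 := ord_max; pose j : 'I_n.+2 := ord0.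
have neq_ij : i != j by [].
have conj_entry X : ~~ is_scalar_mx (GLval X) ->
    exists2 g, g \in S & (GLval (X ^ g) j i != 0)%R.
  move=> nsX; have neq_ji : j != i by [].
  have [P detP Pji] := nonscalar_SL_conj_entry neq_ji nsX.
  by have [g Sg gP] := SL_val (n := n.+2) detP; exists g; rewrite ?GL_conj_val ?gP.
have [g Sg aji] := conj_entry A nsA; have [h Sh bji] := conj_entry B nsB.
set a := A ^ g in aji *; set b := B ^ h in bji *.
have [u Su uE] : exists2 u : F -> {'GL_n.+2[F]}, (forall t, u t \in S)
    & forall t, GLval (u t) = transvection i j t.
  have uP (t : F) : exists u, (u \in S) && (GLval u == transvection i j t).
    have [u Su uE] := SL_val (n := n.+2) (det_transvection t (isT : j < i)).
    by exists u; rewrite Su uE /=.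
  exists (fun t => xchoose (uP t)) => t; have /andP[Su /eqP uE] := xchooseP (uP t) => //.
have [c trE] := trace_transvection_conj i j (GLval a) (GLval b).
pose x t := a ^ u t * b.
have trx t : (\tr (GLval (x t)) = \tr (GLval a *m GLval b) + c * t
                                 - GLval a j i * GLval b j i * t ^+ 2)%R.
  rewrite -trE GL_ME GL_conj_val uE; congr (\tr (_ *m _ *m _ *m _))%R.
  have uT : transvection i j t \in unitmx by rewrite unitmxE det_transvection ?GRing.unitr1.
  by rewrite -[invmx _]mulmx1 -(transvection_mul_opp t neq_ij) mulKmx.
(* The traces of [x t] are the values of [p], whose leading coefficient is nonzero by [aji] and
   [bji]; its degree is exactly 2 in every characteristic. *)
pose p : {poly F} := (Poly [:: \tr (GLval a *m GLval b); c;
                             - (GLval a j i * GLval b j i)])%R.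
have szp : size p = 3.
  by rewrite (@PolyK _ 1%R) //= GRing.oppr_eq0 GRing.mulf_neq0.
have px t : (p.[t] = \tr (GLval (x t)))%R.
  by rewrite trx horner_Poly /=; ring.
rewrite leq_uphalf_double -mul2n.
have := @card_poly_image F p; rewrite szp => /(_ isT)/leq_trans; apply.
rewrite leq_mul2l /= (eq_imset _ px).
apply: (@card_class_count _ (SLgroup_group n.+2 F) _ _ (fun y => \tr (GLval y))%R).
- by move=> y k _ _; apply: mxtrace_conj.
- by rewrite mul_subG ?class_subG.
- exact: class_mul_norm.
by move=> t; rewrite mem_mulg // -?conjgM ?memJ_class // groupM /= ?Su.
Qed.

Theorem theoremB (p m n q : nat) (F : finFieldType)
    (p_prime : prime p) (m_gt0 : (0 < m)%N) (n_ge2 : (2 <= n)%N)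
    (q_def : q = (p ^ m)%N) (F_card : #|F| = q)
    (A B : {'GL_n[F]})
    (SL_A : A \in SLgroup n F) (SL_B : B \in SLgroup n F) :
  (A ^: SLgroup n F * B ^: SLgroup n F = (A * B) ^: SLgroup n F /\
     (is_scalar_mx (GLval A) \/ is_scalar_mx (GLval B)))
  \/ (uphalf q <= class_count (SLgroup n F) (A ^: SLgroup n F * B ^: SLgroup n F)%g)%N.
Proof.
have central X : is_scalar_mx (GLval X) -> X \in 'C(SLgroup n F).
  by move=> sX; apply/centP=> g _; apply: scalar_GL_central.
have [sA|nsA] := boolP (is_scalar_mx (GLval A)).
  by left; split; [apply: (class_mul_cent B (central A sA)) | left].
have [sB|nsB] := boolP (is_scalar_mx (GLval B)).
  left; split; last by right.
  (* When [B] is central, both the elements and the two classes commute, which reduces the claim to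
     the case of a central left factor. *)
  rewrite -(scalar_GL_central A sB) -(class_mul_cent A (central B sB)).
  apply: centC; apply/centsP=> _ /imsetP[g _ ->] _ /imsetP[h _ ->].
  have -> : B ^ h = B by apply/conjg_fixP/commgP/scalar_GL_central.
  exact/commute_sym/scalar_GL_central.
right; rewrite -F_card {central}; case: n n_ge2 => [|[|n]] // _ in A B SL_A SL_B nsA nsB *.
exact: class_count_nonscalar.
Qed.
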